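(* Consider the discontinuous Galerkin discretization of the one-dimensional porous shallow water equations described in the context, in which, at every cell interface $x_{j+1/2}$, the interface values are redefined as $$h^{\pm,*}_{h,j+1/2}=\max\Big(0,\frac{h^{\pm}_{h,j+1/2}}{\phi^{\pm}_{h,j+1/2}}+z^{\pm}_{h,j+1/2}-\max(z^+_{h,j+1/2},z^-_{h,j+1/2})\Big)\min(\phi^+_{h,j+1/2},\phi^-_{h,j+1/2}),\qquad \tilde U^{\pm,*}_{h,j+1/2}=\begin{pmatrix}h^{\pm,*}_{h,j+1/2}\\ (uh)^{\pm}_{h,j+1/2}\end{pmatrix},$$ and the numerical fluxes, with corrector terms, are $$\mathcal F^L_{j+1/2}=\mathcal F(\tilde U^{-,*}_{h,j+1/2},\tilde U^{+,*}_{h,j+1/2})+\begin{pmatrix}0\\ \frac g2\frac{(h^-_{h,j+1/2})^2}{\phi^-_{h,j+1/2}}-\frac g2\frac{(h^{-,*}_{h,j+1/2})^2}{\min(\phi^+_{h,j+1/2},\phi^-_{h,j+1/2})}\end{pmatrix},$$ $$\mathcal F^R_{j-1/2}=\mathcal F(\tilde U^{-,*}_{h,j-1/2},\tilde U^{+,*}_{h,j-1/2})+\begin{pmatrix}0\\ \frac g2\frac{(h^+_{h,j-1/2})^2}{\phi^+_{h,j-1/2}}-\frac g2\frac{(h^{+,*}_{h,j-1/2})^2}{\min(\phi^+_{h,j-1/2},\phi^-_{h,j-1/2})}\end{pmatrix}.$$ Then the scheme is well-balanced: for every still water stationary state, i.e. whenever $(uh)_h=0$ and $h_h/\phi_h+z_h=C$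 for a constant $C$, the residual $$\begin{aligned}R=&-\int_\kappa F(\tilde U_h)\cdot\partial_xP_h\,dx+\mathcal F^L_{j+1/2}\cdot P_h(x^-_{j+1/2})-\mathcal F^R_{j-1/2}\cdot P_h(x^+_{j-1/2})\\&-\int_\kappa S(\tilde U_h)\cdot P_h\,dx-\int_\kappa S_\phi(\tilde U_h)\cdot P_h\,dx\end{aligned}$$ vanishes on every cell $\kappa=[x_{j-1/2},x_{j+1/2}]$ for every test function $P_h$.
   Context: The one-dimensional porous shallow water equations are written in the variables $\tilde U=(h,uh)=(\phi H,\phi uH)$, where $H\ge0$ is water height, $u$ velocity, $\phi\in(0,1]$ porosity, $z$ sediment height and $g>0$ the gravitational acceleration: $\partial_t\tilde U+\partial_xF(\tilde U)=S(\tilde U)+S_\phi(\tilde U)$ with $$F(\tilde U)=\begin{pmatrix}hu\\ hu^2+\frac12gh^2/\phi\end{pmatrix},\quad S(\tilde U)=\begin{pmatrix}0\\-gh\,\partial_xz\end{pmatrix},\quad S_\phi(\tilde U)=\begin{pmatrix}0\\\frac g2\frac{h^2}{\phi^2}\partial_x\phi\end{pmatrix}.$$ The line (interval) is partitioned into cells $\kappa=[x_{j-1/2},x_{j+1/2}]$. The discrete functions $h_h\ge0$, $(uh)_h$, $z_h$, $\phi_h\in(0,1]$ and the test functions $P_h$ (with values in $\mathbb R^2$) are smooth on each cell (e.g. polynomial) and may jump between cells; derivatives are taken cellwise, and cell integrals are exact. Superscripts $-$ and $+$ at $x_{j+1/2}$ denote the limits from the left and from the right. $\mathcal F(a,b)$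 is the (local) Lax–Friedrichs flux $\mathcal F(a,b)=\frac12\big(F(a)+F(b)+\alpha_{\max}(a-b)\big)$, where $\alpha_{\max}$ is the maximum over the two states of the absolute values of the eigenvalues $u\pm\sqrt{gh/\phi}$. In $\mathcal F(\tilde U^{-,*}_{h,j+1/2},\tilde U^{+,*}_{h,j+1/2})$ both starred states use the common porosity value $\min(\phi^+_{h,j+1/2},\phi^-_{h,j+1/2})$. Where $uh=0$ the velocity $u$ (and hence $hu^2$) is taken to be $0$, also if $h=0$. *)

(* Defs.v *)
From mathcomp Require Import all_boot all_order all_algebra.
From mathcomp Require Import all_classical all_reals all_analysis.
Set Implicit Arguments.
Unset Strict Implicit.
Unset Printing Implicit Defensive.
Import Order.TTheory GRing.Theory Num.Theory.
Import numFieldNormedType.Exports.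
Local Open Scope ring_scope.
Local Open Scope classical_set_scope.

Definition vec2 (R : realType) (a b : R) : 'rV[R]_2 := \row_i [:: a; b]`_i.

Definition dot (R : realType) (v w : 'rV[R]_2) : R := \sum_i v 0 i * w 0 i.

Definition component (R : realType) (P : R -> 'rV[R]_2) (i : 'I_2) : R -> R :=
  fun y => P y 0 i.

(* A discrete function is a single function [R -> R]; its values at the nodes
   carry no meaning, the two one-sided limits there are used instead. *)
Definition trL (R : realType) (f : R -> R) (y : R) : R := lim (f t @[t --> y^'-]).
Definition trR (R : realType) (f : R -> R) (y : R) : R := lim (f t @[t --> y^'+]).

(* The node [x j] is x_(j-1/2), so that cell j is [x j, x (j + 1)].  The cells
   may exhaust the line or an interval; a mesh with finitely many cells is
   included by adding the (ghost) cells that provide the exterior states at its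
   two end points. *)
Definition mesh (R : realType) (x : int -> R) : Prop :=
  forall j : int, x j < x (j + 1).

(* C^oo on the closed cell [a, b]: all derivatives exist inside the cell and
   extend continuously to its end points. *)
Definition smooth_on_cell (R : realType) (a b : R) (f : R -> R) : Prop :=
  forall n : nat,
    [/\ forall y, y \in `]a, b[ -> derivable (f^`(n)%classic) y 1,
        cvg (f^`(n)%classic t @[t --> a^'+]) & cvg (f^`(n)%classic t @[t --> b^'-])].

Definition cellwise_smooth (R : realType) (x : int -> R) (f : R -> R) : Prop :=
  forall j : int, smooth_on_cell (x j) (x (j + 1)) f.

Definition cellwise (R : realType) (x : int -> R) (Q : R -> Prop) : Prop :=
  forall (j : int) (y : R), y \in `]x j, x (j + 1)[ -> Q y.

(* The bounds hold on the closed cells, hence also for the traces: positivity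
   in the open cells alone would allow a vanishing trace. *)
Definition porosity (R : realType) (x : int -> R) (phi : R -> R) : Prop :=
  [/\ cellwise x (fun y => 0 < phi y <= 1),
      forall j : int, 0 < trR phi (x j) <= 1
    & forall j : int, 0 < trL phi (x j) <= 1].

(* A state is (h, uh).  As 0 / h = 0 and m / 0 = 0, the velocity is 0 wherever
   uh = 0, also if h = 0. *)
Definition height (R : realType) (U : 'rV[R]_2) : R := U 0 0.
Definition momentum (R : realType) (U : 'rV[R]_2) : R := U 0 1.
Definition velocity (R : realType) (U : 'rV[R]_2) : R := momentum U / height U.

Definition flux (R : realType) (g phi : R) (U : 'rV[R]_2) : 'rV[R]_2 :=
  vec2 (momentum U)
       (height U * velocity U ^+ 2 + g / 2 * (height U ^+ 2 / phi)).

Definition max_speed (R : realType) (g phi : R) (U : 'rV[R]_2) : R :=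
  let c := Num.sqrt (g * height U / phi) in
  Num.max `|velocity U + c| `|velocity U - c|.

(* Lax-Friedrichs flux; both states carry the same porosity [phi]. *)
Definition LF_flux (R : realType) (g phi : R) (a b : 'rV[R]_2) : 'rV[R]_2 :=
  let alpha := Num.max (max_speed g phi a) (max_speed g phi b) in
  2^-1 *: (flux g phi a + flux g phi b + alpha *: (a - b)).

(* In the following definitions [y] is the position of an interface. *)
Definition phi_min (R : realType) (phi : R -> R) (y : R) : R :=
  Num.min (trR phi y) (trL phi y).

Definition z_max (R : realType) (z : R -> R) (y : R) : R :=
  Num.max (trR z y) (trL z y).

Definition hstarL (R : realType) (h z phi : R -> R) (y : R) : R :=
  Num.max 0 (trL h y / trL phi y + trL z y - z_max z y) * phi_min phi y.

Definition hstarR (R : realType) (h z phi : R -> R) (y : R) : R :=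
  Num.max 0 (trR h y / trR phi y + trR z y - z_max z y) * phi_min phi y.

Definition num_flux (R : realType) (g : R) (h uh z phi : R -> R) (y : R) :
    'rV[R]_2 :=
  LF_flux g (phi_min phi y) (vec2 (hstarL h z phi y) (trL uh y))
                            (vec2 (hstarR h z phi y) (trR uh y)).

(* The left flux uses the traces from the left of the interface (it closes the
   cell on the left of [y]), the right flux those from the right. *)
Definition fluxL (R : realType) (g : R) (h uh z phi : R -> R) (y : R) :
    'rV[R]_2 :=
  num_flux g h uh z phi y +
  vec2 0 (g / 2 * (trL h y ^+ 2 / trL phi y)
          - g / 2 * (hstarL h z phi y ^+ 2 / phi_min phi y)).

Definition fluxR (R : realType) (g : R) (h uh z phi : R -> R) (y : R) :
    'rV[R]_2 :=
  num_flux g h uh z phi y +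
  vec2 0 (g / 2 * (trR h y ^+ 2 / trR phi y)
          - g / 2 * (hstarR h z phi y ^+ 2 / phi_min phi y)).

Definition source_bed (R : realType) (g : R) (h z : R -> R) (y : R) :
    'rV[R]_2 :=
  vec2 0 (- (g * h y * z^`()%classic y)).

Definition source_porosity (R : realType) (g : R) (h phi : R -> R) (y : R) :
    'rV[R]_2 :=
  vec2 0 (g / 2 * (h y ^+ 2 / phi y ^+ 2) * phi^`()%classic y).

(* The residual on cell j.  The end points of the cell are negligible for the
   integrals, and inside it the derivatives are the cellwise ones. *)
Definition residual (R : realType) (g : R) (x : int -> R)
    (h uh z phi : R -> R) (P : R -> 'rV[R]_2) (j : int) : R :=
  let mu := @lebesgue_measure R in
  let a := x j in
  let b := x (j + 1) in
  - (\int[mu]_(y in `[a, b])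
       dot (flux g (phi y) (vec2 (h y) (uh y)))
           (\row_i (component P i)^`()%classic y))
  + dot (fluxL g h uh z phi b) (\row_i trL (component P i) b)
  - dot (fluxR g h uh z phi a) (\row_i trR (component P i) a)
  - \int[mu]_(y in `[a, b]) dot (source_bed g h z y) (P y)
  - \int[mu]_(y in `[a, b]) dot (source_porosity g h phi y) (P y).

Definition still_water (R : realType) (x : int -> R) (h uh z phi : R -> R) :
    Prop :=
  cellwise x (fun y => uh y = 0) /\
  exists C : R, cellwise x (fun y => h y / phi y + z y = C).

(* Main.v *)
(* In still water both traces of h / phi + z at an interface equal C and the
   momentum vanishes, so the two starred states coincide; by consistency of the
   Lax-Friedrichs flux, the corrector then reduces each numerical flux to the
   one-sided pressure (0, g/2 h^2 / phi).  Inside a cell, (h / phi + z)' = 0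
   makes the derivative of g/2 h^2 / phi P_1 the sum of the three integrands, and
   the fundamental theorem of calculus cancels them against the boundary terms. *)
Require Import Defs.
From mathcomp Require Import all_boot all_order all_algebra.
From mathcomp Require Import all_classical all_reals all_analysis.
From mathcomp Require Import ring.
Set Implicit Arguments.
Unset Strict Implicit.
Unset Printing Implicit Defensive.
Import Order.TTheory GRing.Theory Num.Theory.
Import numFieldNormedType.Exports.
Local Open Scope classical_set_scope.
Local Open Scope ring_scope.

(** * Functions continuous inside a cell, with limits at its ends *)

Lemma near_right_itvoo (R : realType) (a b : R) : a < b ->
  \forall t \near a^'+, t \in `]a, b[.
Proof.
move=> ab; near=> t; rewrite in_itv/=; apply/andP; split; near: t.
- exact: nbhs_right_gt.
- exact: nbhs_right_lt.
Unshelve. all: by end_near. Qed.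

Lemma near_left_itvoo (R : realType) (a b : R) : a < b ->
  \forall t \near b^'-, t \in `]a, b[.
Proof.
move=> ab; near=> t; rewrite in_itv/=; apply/andP; split; near: t.
- exact: nbhs_left_gt.
- exact: nbhs_left_lt.
Unshelve. all: by end_near. Qed.

(** The values at [a] and [b] stay free, because a discrete function has no meaningful value at a
    node; finite one-sided limits replace continuity there. *)
Definition cell_continuous {R : realType} (a b : R) (f : R -> R) : Prop :=
  [/\ {in `]a, b[, continuous f}, cvg (f t @[t --> a^'+])
    & cvg (f t @[t --> b^'-])].

Section CellContinuous.
Variables (R : realType) (a b : R).
Implicit Types f k F : R -> R.
Let mu := @lebesgue_measure R.

Lemma cell_continuous_cst (c : R) : cell_continuous a b (fun=> c).
Proof. by split=> [y _||]; [exact: cvg_cst|exact: is_cvg_cst..]. Qed.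

Lemma cell_continuousD f k : cell_continuous a b f -> cell_continuous a b k ->
  cell_continuous a b (fun y => f y + k y).
Proof.
move=> [cf fa fb] [ck ka kb]; split=> [y yab||].
- by apply: cvgD; [exact: cf|exact: ck].
- exact: (is_cvgD fa ka).
- exact: (is_cvgD fb kb).
Qed.

Lemma cell_continuousM f k : cell_continuous a b f -> cell_continuous a b k ->
  cell_continuous a b (fun y => f y * k y).
Proof.
move=> [cf fa fb] [ck ka kb]; split=> [y yab||].
- by apply: cvgM; [exact: cf|exact: ck].
- exact: (is_cvgM fa ka).
- exact: (is_cvgM fb kb).
Qed.

Lemma cell_continuousV f : cell_continuous a b f ->
  {in `]a, b[, forall y, f y != 0} -> trR f a != 0 -> trL f b != 0 ->
  cell_continuous a b (fun y => (f y)^-1).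
Proof.
move=> [cf fa fb] f0 fa0 fb0; split=> [y yab||].
- by apply: cvgV; [exact: f0|exact: cf].
- exact: (is_cvgV fa0 fa).
- exact: (is_cvgV fb0 fb).
Qed.

(* The values at the end points of a cell are arbitrary, while compactness and
   the fundamental theorem of calculus need continuity on the closed cell. *)
Definition trace_extension f (y : R) : R :=
  if y == a then trR f a else if y == b then trL f b else f y.

Lemma trace_extension_oo f : {in `]a, b[, trace_extension f =1 f}.
Proof.
move=> y; rewrite in_itv/= => /andP[ay yb].
by rewrite /trace_extension gt_eqF// lt_eqF.
Qed.

Lemma near_trace_extension f y : y \in `]a, b[ ->
  \forall t \near y, f t = trace_extension f t.
Proof.
move=> yab; near=> t; rewrite trace_extension_oo//.
near: t; exact: near_in_itvoo.
Unshelve. all: by end_near. Qed.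

Hypothesis ab : a < b.

Lemma trace_extension_cvg_right f : cvg (f t @[t --> a^'+]) ->
  trace_extension f t @[t --> a^'+] --> trace_extension f a.
Proof.
rewrite {2}/trace_extension eqxx => fa; apply: cvg_trans fa.
apply: near_eq_cvg; near=> t; rewrite trace_extension_oo//.
near: t; exact: near_right_itvoo.
Unshelve. all: by end_near. Qed.

Lemma trace_extension_cvg_left f : cvg (f t @[t --> b^'-]) ->
  trace_extension f t @[t --> b^'-] --> trace_extension f b.
Proof.
rewrite {2}/trace_extension gt_eqF// eqxx => fb; apply: cvg_trans fb.
apply: near_eq_cvg; near=> t; rewrite trace_extension_oo//.
near: t; exact: near_left_itvoo.
Unshelve. all: by end_near. Qed.

Lemma trace_extension_continuous f : cell_continuous a b f ->
  {within `[a, b], continuous (trace_extension f)}.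
Proof.
move=> [cf fa fb]; apply/(continuous_within_itvP _ ab); split.
- move=> y yab; rewrite /continuous_at trace_extension_oo//.
  apply: cvg_trans (cf y yab); apply: near_eq_cvg.
  exact: near_trace_extension.
- exact: trace_extension_cvg_right.
- exact: trace_extension_cvg_left.
Qed.

(** * Integration over a cell *)

Lemma trace_extension_integrable f : cell_continuous a b f ->
  mu.-integrable `]a, b[%classic (EFin \o trace_extension f).
Proof.
move=> cf; apply: (@integrableS _ _ _ mu `[a, b]%classic) => //.
  exact: subset_itv_oo_cc.
apply: continuous_compact_integrable; first exact: segment_compact.
exact: trace_extension_continuous.
Qed.

Lemma cell_continuous_integrable f : cell_continuous a b f ->
  mu.-integrable `]a, b[%classic (EFin \o f).
Proof.
move=> cf; apply: (@eq_integrable _ _ _ mu `]a, b[%classic _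
  (EFin \o trace_extension f)) => //; last exact: trace_extension_integrable.
by move=> y; rewrite inE/= => yab; rewrite trace_extension_oo.
Qed.

(** The end points form a null set, so agreement inside the cell suffices, and [k] inherits its
    measurability there from [f]. *)
Lemma cell_Rintegral_itv_oo f k : cell_continuous a b f ->
  {in `]a, b[, k =1 f} ->
  \int[mu]_(y in `[a, b]) k y = \int[mu]_(y in `]a, b[) f y.
Proof.
move=> /cell_continuous_integrable fi kf.
have ki : mu.-integrable `]a, b[%classic (EFin \o k).
  apply: (@eq_integrable _ _ _ mu `]a, b[%classic _ (EFin \o f)) => //.
  by move=> y; rewrite inE/= => yab; rewrite kf.
rewrite /Rintegral integral_itv_bndoo; last exact: (measurable_int mu).
by apply: eq_Rintegral => y; rewrite inE/= => yab; exact: kf.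
Qed.

(** The fundamental theorem of calculus holds for the trace extensions of [f] and [F], whose end
    values are the traces. *)
Lemma cell_FTC2 f F : cell_continuous a b f ->
  cvg (F t @[t --> a^'+]) -> cvg (F t @[t --> b^'-]) ->
  {in `]a, b[, forall y, is_derive y (1 : R) F (f y)} ->
  \int[mu]_(y in `]a, b[) f y = trL F b - trR F a.
Proof.
move=> cf Fa Fb dF.
rewrite -(@eq_Rintegral _ _ _ mu _ f (trace_extension f)); last first.
  by move=> y; rewrite inE/= => yab; rewrite trace_extension_oo.
have eF : {in `]a, b[, forall y, is_derive y (1 : R) (trace_extension F) (f y)}.
  move=> y yab; apply: near_eq_is_derive (dF y yab).
  exact: near_trace_extension.
have mf := measurable_int mu (trace_extension_integrable cf).
(* The flags [true] and [false] select the closed interval, on which [continuous_FTC2] is stated. *)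
rewrite /Rintegral -(@integral_itv_bndoo _ _ _ _ true false)//.
rewrite (@continuous_FTC2 _ _ (trace_extension F)) //.
- by rewrite /trace_extension eqxx gt_eqF// eqxx.
- exact: trace_extension_continuous.
- split; [|exact: trace_extension_cvg_right|exact: trace_extension_cvg_left].
  by move=> y /eF [].
- move=> y yab; rewrite trace_extension_oo// derive1E.
  by have [_ ->] := eF y yab.
Qed.

(** * Smooth functions on a cell and their traces *)

Lemma smooth_cell_continuous f : smooth_on_cell a b f -> cell_continuous a b f.
Proof.
move=> /(_ 0%N)[df fa fb]; split; [move=> y yab|exact: fa|exact: fb].
(* [smooth_on_cell] speaks of membership in a set, the hypothesis of membership in an interval;
   [inE] links the two. *)
have {}yab : y \in `]a, b[%classic by rewrite inE.
by apply: differentiable_continuous; exact/derivable1_diffP/df.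
Qed.

Lemma smooth_cell_continuous_derive f :
  smooth_on_cell a b f -> cell_continuous a b f^`()%classic.
Proof.
move=> /(_ 1%N); rewrite derive1n1 => -[df fa fb]; split; [move=> y yab|exact: fa|exact: fb].
have {}yab : y \in `]a, b[%classic by rewrite inE.
by apply: differentiable_continuous; exact/derivable1_diffP/df.
Qed.

Lemma smooth_is_derive f y : smooth_on_cell a b f -> y \in `]a, b[ ->
  is_derive y (1 : R) f (f^`()%classic y).
Proof.
move=> /(_ 0%N)[df _ _] yab; rewrite derive1E.
have {}yab : y \in `]a, b[%classic by rewrite inE.
exact/derivableP/df.
Qed.

Lemma trR_eq_cst f (c : R) : {in `]a, b[, forall y, f y = c} -> trR f a = c.
Proof.
move=> fc; apply: cvg_lim => //.
apply: (@cvg_trans _ ((fun=> c) @ a^'+)); last exact: cvg_cst.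
by apply: near_eq_cvg; near=> t; rewrite fc//; near: t; exact: near_right_itvoo.
Unshelve. all: by end_near. Qed.

Lemma trL_eq_cst f (c : R) : {in `]a, b[, forall y, f y = c} -> trL f b = c.
Proof.
move=> fc; apply: cvg_lim => //.
apply: (@cvg_trans _ ((fun=> c) @ b^'-)); last exact: cvg_cst.
by apply: near_eq_cvg; near=> t; rewrite fc//; near: t; exact: near_left_itvoo.
Unshelve. all: by end_near. Qed.

(** The relation passes to the limit at the end point: all three limits exist, and that of [k] is
    nonzero, so the quotient converges. *)
Lemma trR_quotientD (f k l : R -> R) (c : R) : cell_continuous a b f ->
  cell_continuous a b k -> cell_continuous a b l -> trR k a != 0 ->
  {in `]a, b[, forall y, f y / k y + l y = c} ->
  trR f a / trR k a + trR l a = c.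
Proof.
move=> [_ fa _] [_ ka _] [_ la _] k0 /trR_eq_cst <-; apply/esym.
apply: cvg_lim => //; apply: cvgD la; apply: cvgM fa _; exact: cvgV.
Qed.

Lemma trL_quotientD (f k l : R -> R) (c : R) : cell_continuous a b f ->
  cell_continuous a b k -> cell_continuous a b l -> trL k b != 0 ->
  {in `]a, b[, forall y, f y / k y + l y = c} ->
  trL f b / trL k b + trL l b = c.
Proof.
move=> [_ _ fb] [_ _ kb] [_ _ lb] k0 /trL_eq_cst <-; apply/esym.
apply: cvg_lim => //; apply: cvgD lb; apply: cvgM fb _; exact: cvgV.
Qed.

End CellContinuous.

(** * Fluxes of still water at an interface *)

Lemma dot_vec2 (R : realType) (c d : R) (v : 'rV[R]_2) :
  dot (vec2 c d) v = c * v 0 0 + d * v 0 1.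
Proof.
rewrite /dot big_ord_recl big_ord1 !mxE/=; congr (_ + _ * v 0 _).
exact: val_inj.
Qed.

(** The velocity [0 / h] is 0, also for [h = 0], so dry states are covered and only the pressure is
    left. *)
Lemma flux_rest (R : realType) (g p h : R) :
  flux g p (vec2 h 0) = vec2 0 (g / 2 * (h ^+ 2 / p)).
Proof.
by rewrite /flux /velocity /momentum /height !mxE/= mul0r expr0n/= mulr0 add0r.
Qed.

Lemma vec2D (R : realType) (a b c d : R) :
  vec2 a b + vec2 c d = vec2 (a + c) (b + d).
Proof.
by apply/rowP => -[[|[|i]] // ?]; rewrite !mxE.
Qed.

(** The dissipation multiplies the jump [U - U], which vanishes whatever the speed; the mean of two
    equal fluxes remains. *)
Lemma LF_flux_consistent (R : realType) (g p : R) (U : 'rV[R]_2) :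
  LF_flux g p U U = flux g p U.
Proof.
rewrite /LF_flux subrr scaler0 addr0; move: (flux _ _ _) => v.
by rewrite scalerDr -scalerDl -[2^-1]mul1r -splitr scale1r.
Qed.

Section StillWaterInterface.
Variables (R : realType) (g : R) (h uh z phi : R -> R) (y C : R).
Hypotheses (uhL : trL uh y = 0) (uhR : trR uh y = 0).
Hypotheses (levelL : trL h y / trL phi y + trL z y = C)
           (levelR : trR h y / trR phi y + trR z y = C).

(** The two starred heights differ only in the one-sided water level; [z_max] and [phi_min] are
    common to both. *)
Lemma hstar_still : hstarL h z phi y = hstarR h z phi y.
Proof. by rewrite /hstarL /hstarR levelL levelR. Qed.

Lemma num_flux_still : num_flux g h uh z phi y =
  vec2 0 (g / 2 * (hstarL h z phi y ^+ 2 / phi_min phi y)).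
Proof. by rewrite /num_flux -hstar_still uhL uhR LF_flux_consistent flux_rest. Qed.

(** The corrector subtracts exactly the starred pressure produced by [num_flux_still] and adds the
    one-sided one. *)
Lemma fluxL_still :
  fluxL g h uh z phi y = vec2 0 (g / 2 * (trL h y ^+ 2 / trL phi y)).
Proof. by rewrite /fluxL num_flux_still vec2D addr0 addrC subrK. Qed.

Lemma fluxR_still :
  fluxR g h uh z phi y = vec2 0 (g / 2 * (trR h y ^+ 2 / trR phi y)).
Proof. by rewrite /fluxR num_flux_still hstar_still vec2D addr0 addrC subrK. Qed.

End StillWaterInterface.

(** * Derivatives in still water and the balance on one cell *)

Lemma still_level_derive (R : realType) (h z phi : R -> R) (y h' z' phi' C : R) :
  is_derive y (1 : R) h h' -> is_derive y (1 : R) z z' -> is_derive y (1 : R) phi phi' ->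
  phi y != 0 -> (\forall t \near y, h t / phi t + z t = C) ->
  h' = h y * phi' / phi y - phi y * z'.
Proof.
move=> dh dz dphi phi0 level.
have dC : is_derive y (1 : R) (fun t => h t * (phi t)^-1 + z t) 0.
  apply: (@near_eq_is_derive _ _ _ (cst C)).
  by near=> t; apply/esym; near: t.
have dV := is_deriveV phi0 dphi.
have dD := is_deriveD (is_deriveM dh dV) dz.
(* The water level has derivative 0 as a constant and the right-hand side by the product rule; both
   are its unique derivative. *)
have : 0 = h y *: (- phi y ^- 2 *: phi') + (phi y)^-1 *: h' + z'.
  by rewrite -(@derive_val _ _ _ _ _ _ _ dC) -(@derive_val _ _ _ _ _ _ _ dD).
rewrite /GRing.scale/= => e0.
(* [h'] is written so that the derivative of the level, equal to 0 by [e0], appears as a subterm. *)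
have -> : h' = phi y * ((h y * (- phi y ^- 2 * phi') + (phi y)^-1 * h' + z')
   + h y * phi' / phi y ^+ 2 - z') by field.
by rewrite -e0; field.
Unshelve. all: by end_near. Qed.

(** Substituting [h'] from the constant level into [g h h' / phi - g/2 h^2 phi' / phi^2], the
    derivative of the pressure, gives [g/2 h^2 phi' / phi^2 - g h z']: the two sources. *)
Lemma still_pressure_derive (R : realType) (g C : R) (h z phi p : R -> R)
    (y h' z' phi' p' : R) :
  is_derive y (1 : R) h h' -> is_derive y (1 : R) z z' -> is_derive y (1 : R) phi phi' ->
  is_derive y (1 : R) p p' ->
  phi y != 0 -> (\forall t \near y, h t / phi t + z t = C) ->
  is_derive y (1 : R) (fun t => g / 2 * (h t ^+ 2 / phi t) * p t)
    (g / 2 * (h y ^+ 2 / phi y) * p' + - (g * h y * z') * p y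
     + g / 2 * (h y ^+ 2 / phi y ^+ 2) * phi' * p y).
Proof.
move=> dh dz dphi dp phi0 level.
have eh := still_level_derive dh dz dphi phi0 level.
have dV := is_deriveV phi0 dphi.
have dG := is_deriveM (is_deriveM (is_derive_cst (g / 2) y (1 : R))
  (is_deriveM (is_deriveM dh dh) dV)) dp.
apply: (is_derive_eq (f := fun t => g / 2 * (h t ^+ 2 / phi t) * p t) dG).
rewrite /GRing.scale/= eh !mulrfctE/=.
by field.
Qed.

Lemma gt0_le1_neq0 (R : realType) (t : R) : 0 < t <= 1 -> t != 0.
Proof. by move=> /andP[/lt0r_neq0]. Qed.

Section StillWaterCell.
Variables (R : realType) (g C a b : R) (h z phi p : R -> R).
Hypotheses (ab : a < b)
  (h_smooth : smooth_on_cell a b h) (z_smooth : smooth_on_cell a b z)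
  (phi_smooth : smooth_on_cell a b phi) (p_smooth : smooth_on_cell a b p)
  (phi_neq0 : {in `]a, b[, forall y, phi y != 0})
  (phiR_neq0 : trR phi a != 0) (phiL_neq0 : trL phi b != 0)
  (level : {in `]a, b[, forall y, h y / phi y + z y = C}).
Let mu := @lebesgue_measure R.

(** The integrands are prescribed only inside the cell, so that those of the residual fit directly;
    their sum is the derivative of pressure times [p]. *)
Lemma still_cell_balance (f1 f2 f3 : R -> R) :
  {in `]a, b[, forall y, f1 y = g / 2 * (h y ^+ 2 / phi y) * p^`()%classic y} ->
  {in `]a, b[, forall y, f2 y = - (g * h y * z^`()%classic y) * p y} ->
  {in `]a, b[, forall y,
    f3 y = g / 2 * (h y ^+ 2 / phi y ^+ 2) * phi^`()%classic y * p y} ->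
  \int[mu]_(y in `[a, b]) f1 y + \int[mu]_(y in `[a, b]) f2 y
    + \int[mu]_(y in `[a, b]) f3 y
  = g / 2 * (trL h b ^+ 2 / trL phi b) * trL p b
    - g / 2 * (trR h a ^+ 2 / trR phi a) * trR p a.
Proof.
move=> e1 e2 e3.
have ch := smooth_cell_continuous h_smooth.
have cp := smooth_cell_continuous p_smooth.
have cphi := smooth_cell_continuous phi_smooth.
have cV := cell_continuousV cphi phi_neq0 phiR_neq0 phiL_neq0.
have cdz := smooth_cell_continuous_derive z_smooth.
have cdp := smooth_cell_continuous_derive p_smooth.
have cdphi := smooth_cell_continuous_derive phi_smooth.
have ccst := cell_continuous_cst a b.
have ch2 : cell_continuous a b (fun y => h y ^+ 2) := cell_continuousM ch ch.
have cG := cell_continuousM (cell_continuousM (ccst (g / 2))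
  (cell_continuousM ch2 cV)) cp.
have c1 := cell_continuousM (cell_continuousM (ccst (g / 2))
  (cell_continuousM ch2 cV)) cdp.
have c2 : cell_continuous a b (fun y => - (g * h y * z^`()%classic y) * p y).
  (* The opposite becomes a product with the constant -1, to which closure under products
     applies. *)
  under eq_fun do rewrite -mulN1r.
  exact: cell_continuousM (cell_continuousM (ccst (- 1)) (cell_continuousM
    (cell_continuousM (ccst g) ch) cdz)) cp.
have c3 : cell_continuous a b
    (fun y => g / 2 * (h y ^+ 2 / phi y ^+ 2) * phi^`()%classic y * p y).
  (* The inverse of the square becomes the square of the inverse, hence the product of [cV] with
     itself. *)
  under eq_fun do rewrite -exprVn.
  exact: cell_continuousM (cell_continuousM (cell_continuousM (ccst (g / 2))
    (cell_continuousM ch2 (cell_continuousM cV cV))) cdphi) cp.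
have i1 := cell_continuous_integrable ab c1.
have i2 := cell_continuous_integrable ab c2.
have i3 := cell_continuous_integrable ab c3.
have i12 := cell_continuous_integrable ab (cell_continuousD c1 c2).
rewrite (cell_Rintegral_itv_oo ab c1 e1) (cell_Rintegral_itv_oo ab c2 e2).
rewrite (cell_Rintegral_itv_oo ab c3 e3) -RintegralD// -RintegralD//.
have [_ Ga Gb] := cG.
rewrite (cell_FTC2 ab (cell_continuousD (cell_continuousD c1 c2) c3) Ga Gb).
  have [_ ha hb] := ch; have [_ pa pb] := cp; have [_ phia phib] := cphi.
  (* The traces of the primitive are computed from those of [h], [phi] and [p] by the algebra of
     limits. *)
  congr (_ - _); apply: cvg_lim => //.
    exact: cvgM (cvgM (cvg_cst (g / 2))
      (cvgM (cvgM hb hb) (cvgV phiL_neq0 phib))) pb.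
  exact: cvgM (cvgM (cvg_cst (g / 2))
    (cvgM (cvgM ha ha) (cvgV phiR_neq0 phia))) pa.
move=> y yab; apply: (@still_pressure_derive _ g C).
1-4: exact: smooth_is_derive yab.
  exact: phi_neq0.
near=> t; apply: level; near: t; exact: near_in_itvoo.
Unshelve. all: by end_near. Qed.

End StillWaterCell.

(** * The residual on the cells of the mesh *)

Local Open Scope classical_set_scope.

Theorem theorem3 (R : realType) (g : R) (g_gt0 : 0 < g)
    (x : int -> R) (x_mesh : mesh x)
    (h uh z phi : R -> R)
    (h_smooth : cellwise_smooth x h) (uh_smooth : cellwise_smooth x uh)
    (z_smooth : cellwise_smooth x z) (phi_smooth : cellwise_smooth x phi)
    (h_ge0 : cellwise x (fun y => 0 <= h y)) (phi_01 : porosity x phi) :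
  still_water x h uh z phi ->
  forall P : R -> 'rV[R]_2,
    (forall i : 'I_2, cellwise_smooth x (component P i)) ->
    forall j : int, residual g x h uh z phi P j = 0.
Proof.
have [phi_cell phi_R phi_L] := phi_01.
move=> [uh0 [C level]] P P_smooth j.
have uh_in k : {in `]x k, x (k + 1)[%R, forall y, uh y = 0}.
  by move=> y yk; apply: (uh0 k); rewrite inE.
have level_in k : {in `]x k, x (k + 1)[%R, forall y, h y / phi y + z y = C}.
  by move=> y yk; apply: (level k); rewrite inE.
have phi_in k : {in `]x k, x (k + 1)[%R, forall y, phi y != 0}.
  by move=> y yk; apply: gt0_le1_neq0; apply: (phi_cell k); rewrite inE.
have cell f (f_smooth : cellwise_smooth x f) k :=
  smooth_cell_continuous (f_smooth k).
have uhR k : trR uh (x k) = 0 := trR_eq_cst (x_mesh k) (uh_in k).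
(* The trace from the left at [x k] belongs to cell [k - 1], whose right end is [x (k - 1 + 1)]. *)
have uhL k : trL uh (x k) = 0.
  by have := trL_eq_cst (x_mesh (k - 1)) (uh_in (k - 1)); rewrite subrK.
have levelR k : trR h (x k) / trR phi (x k) + trR z (x k) = C.
  apply: (trR_quotientD (x_mesh k)) => //; [exact: cell..|].
  exact: gt0_le1_neq0.
have levelL k : trL h (x k) / trL phi (x k) + trL z (x k) = C.
  rewrite -[k](subrK 1); apply: (trL_quotientD (x_mesh (k - 1))) => //.
  1-3: exact: cell.
  exact: gt0_le1_neq0.
rewrite /residual (fluxL_still _ _ _ (levelL _) (levelR _))//.
rewrite (fluxR_still _ _ _ (levelL _) (levelR _))// !dot_vec2 !mxE !mul0r !add0r.
have sum0 (i1 i2 i3 l r : R) :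
    i1 + i2 + i3 = l - r -> - i1 + l - r - i2 - i3 = 0.
  move=> balance; have -> : i1 = l - r - i3 - i2 by rewrite -balance; ring.
  ring.
(* Fluxes and sources have zero first component, so the scalar balance is applied to the component
   of index 1 of [P]. *)
apply: sum0; apply: (still_cell_balance (x_mesh j) (h_smooth j) (z_smooth j)
  (phi_smooth j) (P_smooth 1 j) (phi_in j) (gt0_le1_neq0 (phi_R j))
  (gt0_le1_neq0 (phi_L (j + 1))) (level_in j)) => y yj.
- by rewrite (uh_in j)// flux_rest dot_vec2 !mxE mul0r add0r.
- by rewrite /source_bed dot_vec2 mul0r add0r.
- by rewrite /source_porosity dot_vec2 mul0r add0r.
Qed.
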